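(* Let $\mathcal{Q}=\{p_1,\dots,p_K\}$ be $K$ known probability distributions on $[M]$, and let $\epsilon>0$ be sufficiently small. (i) For a time horizon (sample size) $T$ there exist a non-interactive $(\epsilon,0)$-locally differentially private mechanism $(\mathcal{R}_1,\dots,\mathcal{R}_T)$ and predictors $\hat p_1,\dots,\hat p_T$, where $\hat p_t$ is a probability distribution on $[M]$ depending on the privatized samples $\mathcal{R}_1(Y_1),\dots,\mathcal{R}_{t-1}(Y_{t-1})$, such that the average $\hat p=\frac1T\sum_{t=1}^T\hat p_t$ satisfies, for every underlying truth $p^*\in\mathcal{Q}$ (i.e. $Y_1,\dots,Y_T$ i.i.d. with law $p^*$), $$\mathbb{E}\,|p^*-\hat p|_{\mathsf{TV}}\le\tilde O\left(\sqrt{\frac1\epsilon\sqrt{\frac KT}}\right).$$ (ii) Consequently, for a target accuracy $\alpha$, taking $T_\alpha=\tilde O\left(\frac{K}{\epsilon^2\alpha^4}\right)$ samples makes the TV-risk $\mathbb{E}\,|p^*-\hat p|_{\mathsf{TV}}$ at most $\alpha$ for every $p^*\in\mathcal{Q}$. (iii) The guarantee in (ii) can be boosted to high probability via a median trick. Hence $\tilde O\left(\frac{K}{\epsilon^2\alpha^4}\right)$ samples suffice for locally private hypothesis selection from $\mathcal{Q}$ with total variation error $\alpha$, with high probability, using non-interactive mechanisms; this recovers the nearly tight upper bound of Gopi et al. (2020) for non-interactive mechanisms in the batch setting.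
   Context: $|p-q|_{\mathsf{TV}}=\sum_{y}\max\{p[y]-q[y],0\}$. $\tilde O$ hides polylogarithmic factors. A non-interactive mechanism is a tuple of randomized maps $\mathcal{R}_t:[M]\to\mathbb{R}^K$ (which may depend on $\mathcal{Q}$, $T$, $\epsilon$), fixed in advance and using independent internal randomness for different $t$. It is $(\epsilon,0)$-locally differentially private if for every $t$, all $y,y'\in[M]$ and every $S\subseteq\mathbb{R}^K$, $\Pr(\mathcal{R}_t(y)\in S)\le e^{\epsilon}\Pr(\mathcal{R}_t(y')\in S)$. Locally private hypothesis selection is the problem of estimating an unknown $p^*\in\mathcal{Q}$ in total variation from privatized i.i.d. samples of $p^*$. The level of ''high probability'' in (iii) is not quantified. *)

(* Defs.v *)
From HB Require Import structures.
From mathcomp Require Import all_boot all_order all_algebra.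
From mathcomp Require Import all_classical all_reals all_analysis.
Set Implicit Arguments.
Unset Strict Implicit.
Unset Printing Implicit Defensive.
Import Order.TTheory GRing.Theory Num.Theory.
Import numFieldNormedType.Exports.
Local Open Scope classical_set_scope.
Local Open Scope ring_scope.

Section distributions.
Context {R : realType} {M : nat}.
Implicit Types p q : 'I_M -> R.

Definition is_dist p : Prop := (forall y, 0 <= p y) /\ \sum_y p y = 1.

Definition tv p q : R := \sum_y Num.max (p y - q y) 0.

End distributions.

Section product_law.
Context d (X : measurableType d) (R : realType).

Section cons_law.
Context (n : nat) (P : probability X R) (Q : probability (n.-tuple X) R).

Definition cons_tuple (x : X * n.-tuple X) : n.+1.-tuple X :=
  [tuple of x.1 :: x.2].

Lemma measurable_cons_tuple : measurable_fun [set: X * n.-tuple X] cons_tuple.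
Proof.
exact: (measurable_cons (f := fst) (g := snd) measurable_fst measurable_snd).
Qed.

Definition cons_law (A : set (n.+1.-tuple X)) : \bar R :=
  (P \x Q)%E (cons_tuple @^-1` A).

Let cons_law0 : cons_law set0 = 0%E.
Proof. by rewrite /cons_law preimage_set0 measure0. Qed.

Let cons_law_ge0 A : (0 <= cons_law A)%E.
Proof. exact: measure_ge0. Qed.

Let measurable_preimage_cons A : measurable A -> measurable (cons_tuple @^-1` A).
Proof. by move=> mA; rewrite -[X in measurable X]setTI; exact: measurable_cons_tuple. Qed.

Let cons_law_sigma_additive : semi_sigma_additive cons_law.
Proof.
move=> F mF tF mUF; rewrite /cons_law preimage_bigcup.
apply: measure_semi_sigma_additive.
- by move=> n0; exact: measurable_preimage_cons.
- apply/trivIsetP => i j _ _ ij; rewrite -preimage_setI.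
  by move/trivIsetP : tF => ->//; rewrite preimage_set0.
- by rewrite -preimage_bigcup; exact: measurable_preimage_cons.
Qed.

HB.instance Definition _ := isMeasure.Build _ _ _ cons_law
  cons_law0 cons_law_ge0 cons_law_sigma_additive.

Let cons_law_setT : cons_law setT = 1%E.
Proof. by rewrite /cons_law preimage_setT probability_setT. Qed.

HB.instance Definition _ :=
  Measure_isProbability.Build _ _ _ cons_law cons_law_setT.

End cons_law.

(* The product P 0 (x) ... (x) P (n-1) of n probability measures; it is
   characterised by its values on boxes, see [tuple_law_box]. *)
Fixpoint tuple_law n : ('I_n -> probability X R) -> probability (n.-tuple X) R :=
  match n with
  | 0 => fun _ => \d_([tuple] : 0.-tuple X)
  | n'.+1 => fun P => cons_law (P ord0) (tuple_law (fun i => P (lift ord0 i)))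
  end.

Lemma tuple_law_box n (P : 'I_n -> probability X R) (A : 'I_n -> set X) :
  (forall i, measurable (A i)) ->
  tuple_law P [set z | forall i, A i (tnth z i)] = (\prod_i P i (A i))%E.
Proof.
elim: n P A => [|n IH] P A mA.
  rewrite big_ord0 /= (_ : [set _ | _] = setT) ?diracT//.
  by apply/seteqP; split => // z _ [].
rewrite big_ord_recl -IH//= /cons_law.
rewrite (_ : _ @^-1` _ =
  A ord0 `*` [set z | forall i, A (lift ord0 i) (tnth z i)]); last first.
  apply/seteqP; split => -[x z] /=.
    move=> h; split; first exact: (h ord0).
    by move=> i; have := h (lift ord0 i); rewrite tnthS.
  move=> [Ax Az] i; case: (unliftP ord0 i) => [j ->|->]; last exact: Ax.
  by rewrite tnthS; exact: Az.
rewrite product_measure1E//.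
rewrite (_ : [set _ | _] = \bigcap_(i : 'I_n)
  ((fun z : n.-tuple X => tnth z i) @^-1` A (lift ord0 i))).
  apply: fin_bigcap_measurable => // i _.
  by rewrite -[X in measurable X]setTI; exact: measurable_tnth.
by apply/seteqP; split => [z h i _|z h i]; exact: h.
Qed.

End product_law.

Section local_privacy.
Context {R : realType} {K M T : nat}.

(* [Rm t y] is the law on R^K of the output of the t-th randomized map on the
   input y; K.-tuple R carries the product Borel sigma-algebra. *)
Definition mechanism := 'I_T -> 'I_M -> probability (K.-tuple R) R.

Definition ldp (eps : R) (Rm : mechanism) : Prop :=
  forall (t : 'I_T) (y y' : 'I_M) (S : set (K.-tuple R)), measurable S ->
    (Rm t y S <= (expR eps)%:E * Rm t y' S)%E.

Variables (Rm : mechanism) (p : 'I_M -> R).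

(* Expectation of F, resp. probability of the event A, for the privatized
   samples (Rm_0(Y_0), ..., Rm_(T-1)(Y_(T-1))), with the Y_t i.i.d. of law p:
   conditionally on the Y_t the outputs are independent, since the maps use
   independent internal randomness. *)
Definition priv_expectation (F : T.-tuple (K.-tuple R) -> R) : \bar R :=
  (\sum_(y : T.-tuple 'I_M) (\prod_(t < T) p (tnth y t))%:E *
     'E_(tuple_law (fun t => Rm t (tnth y t)))[F])%E.

Definition priv_probability (A : set (T.-tuple (K.-tuple R))) : \bar R :=
  (\sum_(y : T.-tuple 'I_M) (\prod_(t < T) p (tnth y t))%:E *
     tuple_law (fun t => Rm t (tnth y t)) A)%E.

End local_privacy.
Arguments mechanism : clear implicits.

Definition is_estimator {d} {Z : measurableType d} {R : realType} {M : nat}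
    (f : Z -> 'I_M -> R) : Prop :=
  (forall y, measurable_fun [set: Z] (f ^~ y)) /\ (forall z, is_dist (f z)).

Definition tuple_prefix {X : Type} {T : nat} (t : 'I_T) (z : T.-tuple X) :
    t.-tuple X :=
  [tuple tnth z (widen_ord (ltnW (ltn_ord t)) s) | s < t].

Section predictors.
Context {R : realType} {K M T : nat}.

(* Indices start at 0, so that the t-th predictor sees exactly the t
   privatized samples that precede it. *)
Definition predictors := forall t : 'I_T, t.-tuple (K.-tuple R) -> 'I_M -> R.

Definition average (ph : predictors) (z : T.-tuple (K.-tuple R)) : 'I_M -> R :=
  fun y => T%:R^-1 * \sum_(t < T) ph t (tuple_prefix t z) y.

Definition tv_risk (Rm : mechanism R K M T) (ph : predictors) (p : 'I_M -> R) :
    \bar R :=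
  priv_expectation Rm p (fun z => tv p (average ph z)).

End predictors.
Arguments predictors : clear implicits.

Section repetition.
Context {m n : nat}.

Lemma pos_of_block (i : 'I_(m * n)) : (0 < n)%N.
Proof. by case: n i => [|//] [i]; rewrite muln0. Qed.

Lemma block_index_subproof (j : 'I_m) (t : 'I_n) : (j * n + t < m * n)%N.
Proof.
apply: (@leq_trans (j.+1 * n)); first by rewrite mulSn addnC ltn_add2r.
by rewrite leq_mul2r ltn_ord orbT.
Qed.

Definition block_index (j : 'I_m) (t : 'I_n) : 'I_(m * n) :=
  Ordinal (block_index_subproof j t).

Definition index_in_block (i : 'I_(m * n)) : 'I_n :=
  Ordinal (ltn_pmod i (pos_of_block i)).

Definition block {X : Type} (z : (m * n).-tuple X) (j : 'I_m) : n.-tuple X :=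
  [tuple tnth z (block_index j t) | t < n].

(* m copies of Rm, each run on its own n samples. *)
Definition repeat_mechanism {R : realType} {K M : nat}
    (Rm : mechanism R K M n) : mechanism R K M (m * n) :=
  fun i => Rm (index_in_block i).

End repetition.
Arguments repeat_mechanism m {n R K M} Rm.

(* c is a median of q_0, ..., q_(m-1) in the metric space of distributions
   under tv: it is the q_j with the smallest closed ball, centred at one of
   the q_l, that contains more than half of them. *)
Definition is_tv_median {R : realType} {M m : nat}
    (q : 'I_m -> 'I_M -> R) (c : 'I_M -> R) : Prop :=
  (exists j, c = q j) /\
  forall (l : 'I_m) (r : R),
    (m < 2 * #|[pred i : 'I_m | (tv (q l) (q i) <= r)%R]|)%N ->
    (m < 2 * #|[pred i : 'I_m | (tv c (q i) <= r)%R]|)%N.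

(* The polylogarithmic factors hidden by soft-O, uniformly in the parameters:
   1 + ln (1 + x) >= 1 for x >= 0. *)
Definition polylog {R : realType} (C : R) (c : nat) (x : R) : R :=
  C * (1 + ln (1 + x)) ^+ c.

(* Main.v *)
(* Every user reports a single random sign: a uniform index k and a sign biased by
   eps / (4 A) times a log-likelihood ratio of Q k on the user's sample, encoded
   as a signed unit vector of R^K. The ratios compare (Q k + mixture) / 2 with the
   uniform mixture of all hypotheses, hence are bounded by A = 1 + ln (1 + K)
   whatever the size of the alphabet. The t-th predictor is the hypothesis with
   the largest estimated score after t reports; since the contribution of the
   mixture to the score is known exactly, the score gap to the truth is twice a
   Kullback-Leibler divergence, so a Pinsker inequality bounds the squared total
   variation by the estimation noise. A coordinate is reported with probability
   1 / K, so the noise of a score has variance of order K A^2 / (eps^2 t), and an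
   exponential moment bound gives E tv^2 = O (A^2 / eps sqrt (K / t)). Averaging
   over t gives the risk; the median of independent blocks boosts it. *)
From HB Require Import structures.
Require Import Defs.
From mathcomp Require Import all_boot all_order all_algebra.
From mathcomp Require Import all_classical all_reals all_analysis.
From mathcomp Require Import zify ring lra.
Set Implicit Arguments.
Unset Strict Implicit.
Unset Printing Implicit Defensive.
Import Order.TTheory GRing.Theory Num.Theory.
Import numFieldNormedType.Exports.
Local Open Scope classical_set_scope.
Local Open Scope ring_scope.

(** * Finitely valued observables and finitely supported laws *)

Section finite_range.
Context d (Z : measurableType d) (R : realType) (O : finType) (f : Z -> O).
Hypothesis mf : forall o, measurable (f @^-1` [set o]).

Lemma measurable_finite_range (S : set O) : measurable (f @^-1` S).
Proof.
rewrite (_ : f @^-1` S = \bigcup_(o in S) (f @^-1` [set o])).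
  by apply: fin_bigcup_measurable => // o _; exact: mf.
by apply/seteqP; split=> [z Sz|z [x Sx /= ->//]]; exists (f z).
Qed.

Lemma measurable_fun_finite_range d' (Y : measurableType d') (g : O -> Y) :
  measurable_fun setT (g \o f).
Proof.
move=> _ B mB; rewrite setTI comp_preimage; exact: measurable_finite_range.
Qed.

Lemma expectation_finite_range (P : probability Z R) (g : O -> R) :
  ('E_P[g \o f] = \sum_o (g o)%:E * P (f @^-1` [set o]))%E.
Proof.
rewrite unlock.
have -> : (fun z => ((g \o f) z)%:E) =
    (fun z => \sum_o (g o)%:E * (\1_(f @^-1` [set o]) z)%:E)%E.
  apply/funext => z; rewrite (bigD1 (f z))//= big1 ?adde0.
    by rewrite indicE mem_set ?mule1.
  by move=> o oz; rewrite indicE memNset ?mule0// => /esym/eqP; apply/negP.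
have iI o : P.-integrable setT (fun z => (\1_(f @^-1` [set o]) z)%:E).
  exact: integrable_indic.
rewrite integral_sum//; last by move=> o; exact: integrableZl.
by apply: eq_bigr => o _; rewrite integralZl// integral_indic// setIT.
Qed.

End finite_range.

Section finitely_supported_law.
Context d (Z : measurableType d) (R : realType) (O : finType).

(** Positivity and total mass are bundled with the mass function so that [finite_law] can carry a
    probability instance. *)
Record finite_dist := FiniteDist {
  fd_mass :> O -> R ;
  fd_ge0 : forall o, 0 <= fd_mass o ;
  fd_sum1 : \sum_o fd_mass o = 1 }.

Context (e : O -> Z) (w : finite_dist).

Definition finite_law (A : set Z) : \bar R :=
  (\sum_o (w o)%:E * \d_(e o) A)%E.

Let finite_law0 : finite_law set0 = 0%E.
Proof. by rewrite /finite_law big1// => o _; rewrite measure0 mule0. Qed.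

Let finite_law_ge0 A : (0 <= finite_law A)%E.
Proof. by apply: sume_ge0 => o _; rewrite mule_ge0// lee_fin fd_ge0. Qed.

Let finite_law_sigma_additive : semi_sigma_additive finite_law.
Proof.
move=> F mF tF mUF; rewrite [X in _ --> X](_ : _ =
    lim ((fun n => \sum_(0 <= i < n) finite_law (F i))%E @ \oo)).
  by apply: is_cvg_ereal_nneg_natsum => k _; exact: finite_law_ge0.
rewrite nneseries_sum//; last by move=> o k _; rewrite mule_ge0// lee_fin fd_ge0.
apply: eq_bigr => o _; rewrite nneseriesZl//; congr (_ * _)%E.
exact: measure_semi_bigcup.
Qed.

HB.instance Definition _ := isMeasure.Build _ _ _ finite_law
  finite_law0 finite_law_ge0 finite_law_sigma_additive.

Let finite_law_setT : finite_law setT = 1%E.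
Proof.
rewrite /finite_law; under eq_bigr do rewrite diracT mule1.
by rewrite sumEFin fd_sum1.
Qed.

HB.instance Definition _ :=
  Measure_isProbability.Build _ _ _ finite_law finite_law_setT.

End finitely_supported_law.

(** * Independent reports *)

Lemma sum_tuple_prod (R : comPzSemiRingType) (O : finType) n (F : 'I_n -> O -> R) :
  \sum_(o : n.-tuple O) \prod_i F i (tnth o i) = \prod_i \sum_x F i x.
Proof.
rewrite bigA_distr_bigA (reindex (@tuple_of_finfun O n)).
  apply: eq_bigr => f _; apply: eq_bigr => i _; congr (F i _).
  by rewrite tnth_mktuple.
by exists (@finfun_of_tuple O n) => x _;
  [exact: tuple_of_finfunK|exact: finfun_of_tupleK].
Qed.

Section iid_mean.
Context (R : realType) (O : finType).

(** Expectation over [n] independent reports of law [w], kept as a finite sum so that no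
    integrability question arises. *)
Definition iid_mean (w : O -> R) n (f : n.-tuple O -> R) : R :=
  \sum_(o : n.-tuple O) (\prod_(i < n) w (tnth o i)) * f o.

Context (w : O -> R).
Hypotheses (w0 : forall o, 0 <= w o) (w1 : \sum_o w o = 1).
Context (n : nat).
Implicit Types f g : n.-tuple O -> R.
Local Notation mean := (@iid_mean w n).

Lemma iid_mean_prod (h : 'I_n -> O -> R) :
  mean (fun o => \prod_i h i (tnth o i)) = \prod_i \sum_x w x * h i x.
Proof.
by rewrite -sum_tuple_prod; apply: eq_bigr => o _; rewrite -big_split.
Qed.

Lemma iid_mean1 : mean (fun=> 1) = 1.
Proof.
under eq_fun do rewrite -[1](@big1_eq _ _ *%R 'I_n (index_enum _) xpredT).
rewrite (iid_mean_prod (fun _ _ => 1)) big1// => i _.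
by under eq_bigr do rewrite mulr1.
Qed.

Lemma iid_meanZ c f : mean (fun o => c * f o) = c * mean f.
Proof. by rewrite /iid_mean mulr_sumr; apply: eq_bigr => o _; rewrite mulrCA. Qed.

Lemma iid_meanD f g : mean (fun o => f o + g o) = mean f + mean g.
Proof. by rewrite -big_split; apply: eq_bigr => o _; rewrite mulrDr. Qed.

Lemma iid_mean_cst c : mean (fun=> c) = c.
Proof.
by rewrite -[in LHS](mulr1 c) (iid_meanZ c (fun=> 1)) iid_mean1 mulr1.
Qed.

Lemma iid_mean_sum (I : finType) (F : I -> n.-tuple O -> R) :
  mean (fun o => \sum_i F i o) = \sum_i mean (F i).
Proof.
rewrite /iid_mean exchange_big/=.
by apply: eq_bigr => o _; rewrite mulr_sumr.
Qed.

Lemma ler_iid_mean f g : (forall o, f o <= g o) -> mean f <= mean g.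
Proof.
move=> fg; apply: ler_sum => o _; apply: ler_wpM2l => //.
by apply: prodr_ge0 => i _.
Qed.

Lemma iid_mean_ge0 f : (forall o, 0 <= f o) -> 0 <= mean f.
Proof. by move=> f0; rewrite -(iid_mean_cst 0); exact: ler_iid_mean. Qed.

End iid_mean.

Section block_independence.
Context (R : realType) (O : finType) (m n : nat).

Lemma block_of_subproof (i : 'I_(m * n)) : (i %/ n < m)%N.
Proof. by rewrite ltn_divLR// (pos_of_block i). Qed.

Definition block_of (i : 'I_(m * n)) : 'I_m := Ordinal (block_of_subproof i).

Lemma block_indexK (i : 'I_(m * n)) :
  block_index (block_of i) (index_in_block i) = i.
Proof. by apply: val_inj; rewrite /= -divn_eq. Qed.

Lemma block_of_index (j : 'I_m) (t : 'I_n) : block_of (block_index j t) = j.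
Proof.
apply: val_inj; rewrite /= divnMDl ?divn_small ?addn0//.
exact: leq_ltn_trans (ltn_ord t).
Qed.

Lemma index_in_block_index (j : 'I_m) (t : 'I_n) :
  index_in_block (block_index j t) = t.
Proof. by apply: val_inj; rewrite /= modnMDl modn_small. Qed.

Definition unblock (F : {ffun 'I_m -> n.-tuple O}) : (m * n).-tuple O :=
  [tuple tnth (F (block_of i)) (index_in_block i) | i < m * n].

Lemma block_unblock F j : block (unblock F) j = F j.
Proof.
by apply: eq_from_tnth => t;
  rewrite !tnth_mktuple block_of_index index_in_block_index.
Qed.

Lemma unblock_block (o : (m * n).-tuple O) : unblock [ffun j => block o j] = o.
Proof.
by apply: eq_from_tnth => i; rewrite tnth_mktuple ffunE tnth_mktuple block_indexK.
Qed.

(** The bijection between [i] and [(i %/ n, i %% n)] splits the weight over the blocks;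
    distributivity then gives their independence. *)
Lemma iid_mean_blocks (w : O -> R) (h : n.-tuple O -> R) :
  iid_mean w (fun o : (m * n).-tuple O => \prod_(j < m) h (block o j)) =
  iid_mean w h ^+ m.
Proof.
rewrite /iid_mean -[in RHS](card_ord m) -prodr_const bigA_distr_bigA/=.
rewrite (reindex unblock)/=; last first.
  exists (fun o => [ffun j => block o j]) => x _; last exact: unblock_block.
  by apply/ffunP => j; rewrite ffunE block_unblock.
apply: eq_bigr => F _; rewrite big_split/=; congr (_ * _); last first.
  by apply: eq_bigr => j _; rewrite block_unblock.
rewrite pair_big/= (reindex (fun i => (block_of i, index_in_block i)))/=.
  by apply: eq_bigr => i _; rewrite tnth_mktuple.
exists (fun jt => block_index jt.1 jt.2) => [i _|[j t] _] /=.
  exact: block_indexK.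
by rewrite block_of_index index_in_block_index.
Qed.

End block_independence.

(** * From the privatized law to finite sums *)

Section finite_channel.
Context (R : realType) (K M T : nat) (O : finType) (dec : K.-tuple R -> O).
Hypothesis mdec : forall o, measurable (dec @^-1` [set o]).

Lemma measurable_map_fiber n (o : n.-tuple O) :
  measurable (map_tuple dec @^-1` [set o] : set (n.-tuple (K.-tuple R))).
Proof.
rewrite (_ : _ @^-1` _ = \bigcap_(i : 'I_n)
    ((fun z => tnth z i) @^-1` (dec @^-1` [set tnth o i]))).
  apply: fin_bigcap_measurable => // i _.
  by rewrite -[X in measurable X]setTI; apply: measurable_tnth.
apply/seteqP; split=> [z /= <- i _ /=|z oz]; first by rewrite tnth_map.
by apply: eq_from_tnth => i; rewrite tnth_map; exact: oz.
Qed.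

Context (Rm : mechanism R K M T) (W : 'I_M -> O -> R).
Hypothesis RmW : forall t y o, Rm t y (dec @^-1` [set o]) = (W y o)%:E.

(** Given the samples, the decoded reports are independent; averaging each factor over its own
    sample leaves independent reports of the mixed law. *)
Lemma priv_expectation_iid_mean (p : 'I_M -> R) (f : T.-tuple O -> R) :
  priv_expectation Rm p (fun z => f (map_tuple dec z)) =
  (iid_mean (fun o => \sum_y p y * W y o) f)%:E.
Proof.
rewrite /priv_expectation.
transitivity (\sum_(y : T.-tuple 'I_M) (\prod_(t < T) p (tnth y t))%:E *
    (\sum_(o : T.-tuple O) f o * \prod_t W (tnth y t) (tnth o t))%:E)%E.
  apply: eq_bigr => y _; congr (_ * _)%E.
  have := expectation_finite_range (@measurable_map_fiber T)
    (tuple_law (fun t => Rm t (tnth y t))) f.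
  move=> /= ->; rewrite -sumEFin; apply: eq_bigr => o _.
  rewrite EFinM; congr (_ * _)%E.
  rewrite (_ : _ @^-1` _ = [set z | forall t, (dec @^-1` [set tnth o t]) (tnth z t)]).
    rewrite (@tuple_law_box _ _ _ T _ (fun t => dec @^-1` [set tnth o t])) => [|t].
      by rewrite -prodEFin; apply: eq_bigr => t _; exact: RmW.
    exact: mdec.
  apply/seteqP; split=> [z /= <- i /=|z oz]; first by rewrite tnth_map.
  by apply: eq_from_tnth => i; rewrite tnth_map; exact: oz.
under eq_bigr do rewrite -EFinM.
rewrite sumEFin; congr EFin; rewrite /iid_mean.
under eq_bigr do rewrite mulr_sumr.
rewrite exchange_big/=; apply: eq_bigr => o _.
rewrite -(sum_tuple_prod (fun t y => p y * W y (tnth o t))) mulr_suml.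
by apply: eq_bigr => y _; rewrite big_split/= [f o * _]mulrC mulrA.
Qed.

Lemma priv_probability_expectation (p : 'I_M -> R) (A : set (T.-tuple (K.-tuple R))) :
  measurable A -> priv_probability Rm p A = priv_expectation Rm p \1_A.
Proof.
by move=> mA; apply: eq_bigr => y _; rewrite expectation_indic.
Qed.

End finite_channel.

Section decoding.
Context (R : realType) (K : nat) (O : finType) (e : O -> K.-tuple R) (o0 : O).
Hypothesis e_inj : injective e.

(** Points off the range of [e], which [finite_law e w] does not charge, go to the default [o0]. *)
Definition decode (z : K.-tuple R) : O := odflt o0 [pick o | z == e o].

Lemma decodeK : cancel e decode.
Proof.
move=> o; rewrite /decode; case: pickP => [x /eqP/e_inj //|/(_ o)].
by rewrite eqxx.
Qed.

Lemma measurable_tuple_set1 (z : K.-tuple R) : measurable [set z].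
Proof.
rewrite (_ : [set z] = \bigcap_(i : 'I_K) ((fun x => tnth x i) @^-1` [set tnth z i])).
  apply: fin_bigcap_measurable => // i _.
  by rewrite -[X in measurable X]setTI; apply: measurable_tnth.
by apply/seteqP; split=> [x -> //|x xz]; apply: eq_from_tnth => i; exact: xz.
Qed.

(** Fibres over [o != o0] are singletons; the fibre over [o0] is the complement of these finitely
    many. *)
Lemma measurable_decode o : measurable (decode @^-1` [set o]).
Proof.
have mfib o' : o' != o0 -> measurable (decode @^-1` [set o']).
  move=> oo0; rewrite (_ : _ @^-1` _ = [set e o']); first exact: measurable_tuple_set1.
  apply/seteqP; split=> [z /=|z ->]; last exact: decodeK.
  rewrite /decode; case: pickP => [x /eqP -> /= <- //|_ /= /esym/eqP].
  by rewrite (negbTE oo0).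
have [->|/mfib//] := eqVneq o o0.
rewrite (_ : _ @^-1` _ = ~` \bigcup_(o' in [set x | x != o0]) (decode @^-1` [set o'])).
  apply: measurableC; apply: fin_bigcup_measurable => [|x]; last exact: mfib.
  exact: finite_finset.
apply/seteqP; split=> [z /= zo [x /= oo0 zx]|z zo].
  by move: oo0; rewrite -zx zo eqxx.
by apply/eqP; apply: contra_notT zo => zo; exists (decode z).
Qed.

Lemma finite_law_decode (w : finite_dist R O) o :
  finite_law e w (decode @^-1` [set o]) = (w o)%:E.
Proof.
rewrite /finite_law (bigD1 o)//= big1.
  by rewrite adde0 diracE mem_set ?mule1//= decodeK.
move=> o' oo'; rewrite diracE memNset ?mule0//=.
by rewrite decodeK; exact/eqP.
Qed.

End decoding.

(** * Total variation *)

Section total_variation.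
Context (R : realType) (M : nat).
Implicit Types p q r : 'I_M -> R.

Lemma tv_ge0 p q : 0 <= tv p q.
Proof. by apply: sumr_ge0 => y _; rewrite le_max lexx orbT. Qed.

Lemma tv_le1 p q : is_dist p -> is_dist q -> tv p q <= 1.
Proof.
move=> [p0 p1] [q0 q1]; rewrite -p1; apply: ler_sum => y _.
by rewrite ge_max p0 lerBlDr lerDl q0.
Qed.

(** [p - q] sums to zero, so its positive and negative parts have equal mass. *)
Lemma tv_sym p q : is_dist p -> is_dist q -> tv p q = tv q p.
Proof.
move=> [_ p1] [_ q1]; apply/eqP; rewrite -subr_eq0 /tv -sumrB.
rewrite (eq_bigr (fun y => p y - q y)) ?sumrB ?p1 ?q1 ?subrr// => y _.
by have [|] := leP (p y - q y) 0; have [|] := leP (q y - p y) 0; lra.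
Qed.

Lemma tv_triangle p q r : tv p r <= tv p q + tv q r.
Proof.
rewrite -big_split; apply: ler_sum => y _ /=.
have [|] := leP (p y - q y) 0; have [|] := leP (q y - r y) 0;
  have [|] := leP (p y - r y) 0; lra.
Qed.

(** The positive part is a convex function, hence [tv] is convex in its second argument. *)
Lemma tv_average_le (n : nat) p (q : 'I_n -> 'I_M -> R) : (0 < n)%N ->
  tv p (fun y => n%:R^-1 * \sum_t q t y) <= n%:R^-1 * \sum_t tv p (q t).
Proof.
move=> n0; have nR : 0 < n%:R :> R by rewrite ltr0n.
rewrite exchange_big/= mulr_sumr; apply: ler_sum => y _.
rewrite ge_max; apply/andP; split; last first.
  by rewrite mulr_ge0 ?invr_ge0 ?ler0n//; apply: sumr_ge0 => t _; rewrite le_max lexx orbT.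
rewrite [leLHS](_ : _ = n%:R^-1 * \sum_(t < n) (p y - q t y)).
  rewrite ler_pM2l ?invr_gt0//; apply: ler_sum => t _.
  by rewrite le_max lexx.
by rewrite sumrB sumr_const card_ord -[p y *+ n]mulr_natl mulrBr mulKf ?gt_eqF.
Qed.

Lemma is_dist_average (n : nat) (q : 'I_n -> 'I_M -> R) : (0 < n)%N ->
  (forall t, is_dist (q t)) -> is_dist (fun y => n%:R^-1 * \sum_t q t y).
Proof.
move=> n0 dq; split=> [y|].
  by rewrite mulr_ge0 ?invr_ge0 ?ler0n//; apply: sumr_ge0 => t _; apply: (dq t).1.
rewrite -mulr_sumr exchange_big/= (eq_bigr (fun=> 1)) => [|t _]; last exact: (dq t).2.
by rewrite sumr_const card_ord mulVf// pnatr_eq0 -lt0n.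
Qed.

(* Pinsker's inequality up to a constant, through the Hellinger distance:
   KL >= sum (sqrt p - sqrt q)^2 because ln x <= 2 (sqrt x - 1), and
   2 s (p - q) <= (sqrt p - sqrt q)^2 + 4 s^2 p where p > q, used with
   s = tv p q / 4. *)
Lemma tv_sqr_le_KL p q : is_dist p -> is_dist q ->
  (forall y, q y = 0 -> p y = 0) ->
  tv p q ^+ 2 <= 4 * \sum_y p y * (ln (p y) - ln (q y)).
Proof.
move=> [p0 p1] [q0 q1] pq.
set H := \sum_y (Num.sqrt (p y) - Num.sqrt (q y)) ^+ 2.
have HKL : H <= \sum_y p y * (ln (p y) - ln (q y)).
  (* As [p] and [q] have equal mass, the terms [q y - p y] sum to zero. *)
  have -> : H = \sum_y (2 * (p y - Num.sqrt (p y) * Num.sqrt (q y)) + (q y - p y)).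
    apply: eq_bigr => y _; rewrite sqrrB !sqr_sqrtr//; ring.
  rewrite big_split/= sumrB p1 q1 subrr addr0; apply: ler_sum => y _.
  have := p0 y; rewrite le_eqVlt => /predU1P[<-|py0].
    by rewrite sqrtr0 !mul0r subr0 mulr0.
  have qy0 : 0 < q y.
    rewrite lt_neqAle q0 andbT; apply/eqP => /esym/pq py.
    by rewrite py ltxx in py0.
  have sp : 0 < Num.sqrt (p y) by rewrite sqrtr_gt0.
  have sq : 0 < Num.sqrt (q y) by rewrite sqrtr_gt0.
  have pE : p y = Num.sqrt (p y) ^+ 2 by rewrite sqr_sqrtr.
  have qE : q y = Num.sqrt (q y) ^+ 2 by rewrite sqr_sqrtr.
  move: sp sq pE qE; set a := Num.sqrt (p y); set b := Num.sqrt (q y).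
  move=> a0 b0 -> ->; rewrite !lnXn// -mulrnBl -ln_div//.
  have /le_ln1Dx : -1 < b / a - 1 by rewrite ltrBDr addrC subrr divr_gt0.
  rewrite addrC subrK => lnba.
  have -> : ln (a / b) = - ln (b / a) by rewrite -lnV ?posrE ?divr_gt0// invf_div.
  have -> : 2 * (a ^+ 2 - a * b) = a ^+ 2 * ((1 - b / a) *+ 2).
    by field; rewrite gt_eqF.
  by rewrite ler_pM2l ?exprn_gt0// lerMn2r/= -[leRHS]opprK -opprB lerN2 opprK.
set s := tv p q / 4.
have s0 : 0 <= s by rewrite divr_ge0// tv_ge0.
have key : 2 * s * tv p q <= H + 4 * s ^+ 2.
  move: s s0 => s s0.
  have -> : H + 4 * s ^+ 2 = \sum_y
      ((Num.sqrt (p y) - Num.sqrt (q y)) ^+ 2 + 4 * s ^+ 2 * p y).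
    by rewrite big_split/= -mulr_sumr p1 mulr1.
  rewrite mulr_sumr; apply: ler_sum => y _.
  have pE : p y = Num.sqrt (p y) ^+ 2 by rewrite sqr_sqrtr.
  have qE : q y = Num.sqrt (q y) ^+ 2 by rewrite sqr_sqrtr.
  have sp := sqrtr_ge0 (p y); have sq := sqrtr_ge0 (q y).
  have [_|pqy] := leP (p y - q y) 0.
    rewrite mulr0; apply: addr_ge0; first exact: sqr_ge0.
    by apply: mulr_ge0 => //; apply: mulr_ge0 => //; exact: sqr_ge0.
  have ab : Num.sqrt (q y) <= Num.sqrt (p y) by rewrite ler_wsqrtr//; lra.
  rewrite {1 3}pE {1}qE; move: sp sq ab.
  set a := Num.sqrt (p y); set b := Num.sqrt (q y) => a0 b0 ab.
  (* Arithmetic-geometric mean inequality for [2 s (a - b) (a + b)], followed by [a + b <= 2 a]. *)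
  apply: (@le_trans _ _ ((a - b) ^+ 2 + (s * (a + b)) ^+ 2)).
    by rewrite -subr_ge0 [leRHS](_ : _ = ((a - b) - s * (a + b)) ^+ 2) ?sqr_ge0//; ring.
  have -> : 4 * s ^+ 2 * a ^+ 2 = (s * (2 * a)) ^+ 2 by ring.
  rewrite lerD2l ler_sqr ?nnegrE ?mulr_ge0 ?mulr_ge0 ?addr_ge0//.
  by apply: ler_wpM2l => //; lra.
(* With [tv p q = 4 s], [key] reads [8 s^2 <= H + 4 s^2], that is [16 s^2 <= 4 H]. *)
have : tv p q ^+ 2 <= 4 * H.
  have -> : 4 * H = 4 * (H + 4 * s ^+ 2) - 16 * s ^+ 2 by ring.
  have -> : tv p q = 4 * s by rewrite /s; field.
  by move: key; rewrite (_ : tv p q = 4 * s); [lra|rewrite /s; field].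
by move=> /le_trans; apply; rewrite ler_pM2l.
Qed.

End total_variation.

(** [expR x <= 1 / (1 - x)], and [(1 + x + 2 x^2) (1 - x) = 1 + x^2 (1 - 2 x)] is at least 1. *)
Lemma expR_le_quadratic (R : realType) (x : R) : x <= 2^-1 ->
  expR x <= 1 + x + 2 * x ^+ 2.
Proof.
move=> x2; have := expR_ge1Dx (- x); rewrite expRN => h.
have x1 : 0 < 1 - x by lra.
have : expR x <= (1 - x)^-1 by rewrite -[leLHS]invrK lef_pV2 ?posrE ?invr_gt0 ?expR_gt0.
move=> /le_trans; apply; rewrite -[leLHS]mul1r ler_pdivrMr//.
have : 0 <= x ^+ 2 * (1 - 2 * x) by rewrite mulr_ge0 ?sqr_ge0//; lra.
rewrite (_ : (1 + x + 2 * x ^+ 2) * (1 - x) = 1 + x ^+ 2 * (1 - 2 * x)); first lra.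
by ring.
Qed.

(** * Medians in total variation *)

Section median.
Context (R : realType) (M m : nat).

(** Each [q l] has a least majority radius [rho l], attained among the finitely many distances from
    [q l]; a median minimises [rho]. *)
Lemma tv_median_exists (q : 'I_m -> 'I_M -> R) : (0 < m)%N ->
  exists c, is_tv_median q c.
Proof.
move=> m0; have i0 : 'I_m by exact: Ordinal m0.
pose big l r := (m < 2 * #|[pred i : 'I_m | (tv (q l) (q i) <= r)%R]|)%N.
have bigW l r r' : r <= r' -> big l r -> big l r'.
  move=> rr' /leq_trans; apply; rewrite leq_mul2l/=; apply: subset_leq_card.
  by apply/fintype.subsetP => i; rewrite !inE => /le_trans; exact.
have [rho rhoP] : exists rho : 'I_m -> R, forall l r, big l r <-> rho l <= r.
  suff h l : exists a, forall r, big l r <-> a <= r.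
    by have [f fP] := choice h; exists f.
  pose c i := tv (q l) (q i).
  have [imax _ himax] : extremum_spec >=%O xpredT c (Order.arg_max i0 xpredT c).
    exact: arg_maxP.
  have bmax : big l (c imax).
    rewrite /big (eq_card (B := 'I_m)) ?card_ord ?mul2n ?ltn_Pdouble//.
      by rewrite -addnn -[X in (X < _)%N]addn0 ltn_add2l.
    by move=> i; rewrite !inE; exact: himax.
  case: (@arg_minP _ _ _ imax (fun i => big l (c i)) c bmax) => imin bmin hmin.
  exists (c imin) => r; split=> [br|/bigW]; last exact.
  pose S := [pred i : 'I_m | c i <= r].
  (* [r] need not be a distance: the largest distance not exceeding [r] defines a ball with the same
     indices. *)
  have /card_gt0P[j0 j0S] : (0 < #|S|)%N.
    by move: br; rewrite /big -/S; case: #|S|; rewrite // muln0.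
  case: (@arg_maxP _ _ _ j0 S c j0S) => j jS hj.
  apply: le_trans jS; apply: hmin; apply: leq_trans br _.
  rewrite leq_mul2l/=; apply: subset_leq_card; apply/fintype.subsetP => i iS.
  by rewrite inE; exact: hj.
case: (@arg_minP _ _ _ i0 xpredT rho isT) => j _ hj.
exists (q j); split; first by exists j.
move=> l r /(rhoP l r) lr; apply/(rhoP j r); exact: le_trans (hj l isT) lr.
Qed.

(* Some q_i lies both in the ball of radius 2r around the median and in the
   majority ball around p. *)
Lemma tv_median_le (q : 'I_m -> 'I_M -> R) c p r :
  (forall i, is_dist (q i)) -> is_dist p -> is_tv_median q c ->
  (m < 2 * #|[pred i : 'I_m | (tv p (q i) <= r)%R]|)%N -> tv p c <= 3 * r.
Proof.
move=> dq dp [[j ->] med] maj.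
pose S := [pred i : 'I_m | tv p (q i) <= r].
have /card_gt0P[l lS] : (0 < #|S|)%N.
  by move: maj; rewrite -/S; case: #|S|; rewrite // muln0.
(* [q l] is within [r] of [p], so its ball of radius [2 r] contains the majority ball around [p];
   the median inherits this radius. *)
have /med maj2 : (m < 2 * #|[pred i : 'I_m | (tv (q l) (q i) <= 2 * r)%R]|)%N.
  apply: leq_trans maj _; rewrite leq_mul2l/=; apply: subset_leq_card.
  apply/fintype.subsetP => i; rewrite !inE => iS.
  apply: le_trans (tv_triangle _ p _) _; rewrite tv_sym// mulr_natl mulr2n.
  exact: lerD.
pose S2 := [pred i : 'I_m | tv (q j) (q i) <= 2 * r].
have [i iS iS2] : exists2 i, i \in S & i \in S2.
  apply/exists_inP; apply: contraT; rewrite negb_exists_in => /forall_inP dis.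
  have : (#|S| + #|S2| <= m)%N.
    rewrite -cardUI [X in (_ + X)%N]eq_card0 ?addn0.
      by rewrite -[X in (_ <= X)%N]card_ord max_card.
    move=> i; rewrite !inE; apply/negP => /andP[iS]; apply/negP; exact: dis.
  by move: maj maj2; rewrite -/S -/S2; lia.
apply: le_trans (tv_triangle _ (q i) _) _.
rewrite (_ : 3 * r = r + 2 * r); last by ring.
by apply: lerD; rewrite // tv_sym.
Qed.

End median.

(** * Selection from random signs *)

(** The reports after the prefix contribute factors equal to the total mass 1. *)
Lemma iid_mean_prefix_prod (R : realType) (O : finType) (w h : O -> R) T (t : 'I_T) :
  \sum_o w o = 1 ->
  iid_mean w (fun o : T.-tuple O => \prod_(s < t) h (tnth (tuple_prefix t o) s)) =
  (\sum_x w x * h x) ^+ t.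
Proof.
move=> w1; have tT := ltnW (ltn_ord t).
pose g (s : 'I_T) x := if (s < t)%N then h x else 1.
rewrite [LHS](_ : _ = iid_mean w (fun o : T.-tuple O => \prod_s g s (tnth o s))).
  rewrite iid_mean_prod (eq_bigr (fun s : 'I_T =>
      if (s < t)%N then \sum_x w x * h x else 1)) => [|s _].
    by rewrite -big_mkcond (big_ord_narrow tT)/= prodr_const card_ord.
  rewrite /g; case: ifP => // _.
  by under eq_bigr do rewrite mulr1.
apply: eq_bigr => o _; congr (_ * _); rewrite /g -big_mkcond (big_ord_narrow tT).
apply: eq_bigr => s _; rewrite tnth_mktuple.
by congr (h (tnth o _)); exact: val_inj.
Qed.

Section hypothesis_selection.
Context (R : realType) (K M : nat) (Q : 'I_K -> 'I_M -> R) (eps : R) (k0 : 'I_K).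
Hypotheses (dQ : forall k, is_dist (Q k)) (eps0 : 0 < eps) (eps1 : eps <= 1).

Let K0 : (0 < K)%N. Proof. exact: leq_ltn_trans (ltn_ord k0). Qed.
Let KR : 0 < K%:R :> R. Proof. by rewrite ltr0n K0. Qed.

Definition mixture (y : 'I_M) : R := K%:R^-1 * \sum_k Q k y.

Definition log_range : R := 1 + ln (1 + K%:R).

(* Averaging with the mixture keeps the log-likelihood ratio bounded by
   log_range. Where the mixture vanishes so does every Q k, and the value is
   ln (0 / 0) = 0. *)
Definition log_ratio (k : 'I_K) (y : 'I_M) : R :=
  ln ((Q k y + mixture y) / (2 * mixture y)).

Local Notation A := log_range.

Lemma log_range_ge1 : 1 <= A.
Proof. by rewrite lerDl ln_ge0// lerDl. Qed.

Let A0 : 0 < A. Proof. exact: lt_le_trans log_range_ge1. Qed.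

Lemma is_dist_mixture : is_dist mixture.
Proof. exact: is_dist_average. Qed.

Lemma le_mixture k y : Q k y <= K%:R * mixture y.
Proof.
rewrite /mixture mulVKf ?gt_eqF// (bigD1 k)//= lerDl.
by apply: sumr_ge0 => j _; apply: (dQ j).1.
Qed.

(** Where the mixture is positive, the ratio lies between [1 / 2] and [1 + K], and
    [ln 2 <= 1 <= A]. *)
Lemma log_ratio_bound k y : `|log_ratio k y| <= A.
Proof.
rewrite /log_ratio; have := is_dist_mixture.1 y; rewrite le_eqVlt => /predU1P[<-|m0].
  by rewrite mulr0 invr0 mulr0 ln0// normr0 ltW.
have q0 := (dQ k).1 y; have qm := le_mixture k y.
move: (mixture y) m0 qm => m m0 qm.
have le2 : (Q k y + m) / (2 * m) <= 1 + K%:R.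
  rewrite ler_pdivrMr ?mulr_gt0// mulrDl mul1r.
  have : 0 <= K%:R * m by rewrite mulr_ge0// ltW.
  lra.
have ge2 : 2^-1 <= (Q k y + m) / (2 * m).
  by rewrite ler_pdivlMr ?mulr_gt0// mulKf//; lra.

have pos : 0 < (Q k y + m) / (2 * m) by apply: lt_le_trans ge2; rewrite invr_gt0.
rewrite ler_norml; apply/andP; split; last first.
  apply: (@le_trans _ _ (ln (1 + K%:R))); last by rewrite /log_range; lra.
  by rewrite ler_ln ?posrE//; lra.
apply: (@le_trans _ _ (ln 2^-1)); last by rewrite ler_ln ?posrE ?invr_gt0.
rewrite lnV ?posrE// lerN2.
have : ln (1 + 1) <= 1 :> R by rewrite le_ln1Dx//; lra.
have := log_range_ge1; lra.
Qed.

(* The sum is twice the Kullback-Leibler divergence between the averages of Q k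
   and Q j with the mixture, whose total variation distance is tv (Q k) (Q j) / 2. *)
Lemma tv_sqr_le_log_ratio k j : tv (Q k) (Q j) ^+ 2 <=
  8 * \sum_y (Q k y + mixture y) * (log_ratio k y - log_ratio j y).
Proof.
pose q i y := (Q i y + mixture y) / 2.
have [m0 m1] := is_dist_mixture.
have dq i : is_dist (q i).
  split=> [y|]; first by rewrite divr_ge0// addr_ge0 ?(dQ i).1.
  by rewrite -mulr_suml big_split/= m1 (dQ i).2 divff.
(* All the [q i] vanish exactly where the mixture does, which gives the absolute continuity required
   by Pinsker's inequality. *)
have qm i y : q i y = 0 -> mixture y = 0.
  rewrite /q => /eqP; rewrite mulf_eq0 invr_eq0 pnatr_eq0 orbF.
  by rewrite paddr_eq0 ?(dQ i).1// => /andP[_ /eqP].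
have mq i y : mixture y = 0 -> q i y = 0.
  move=> my; rewrite /q my addr0; have := le_mixture i y; rewrite my mulr0.
  by have := (dQ i).1 y; move=> a b; rewrite (_ : Q i y = 0) ?mul0r//; apply/le_anti/andP.
have /(_ (fun y => mq k y \o qm j y)) := tv_sqr_le_KL (dq k) (dq j).
have -> : tv (q k) (q j) = tv (Q k) (Q j) / 2.
  rewrite /tv mulr_suml; apply: eq_bigr => y _.
  rewrite /q (_ : _ - _ = (Q k y - Q j y) / 2); last by field.
  by have [|] := leP (Q k y - Q j y) 0; have [|] := leP ((Q k y - Q j y) / 2) 0; lra.
(* The constant: [(tv / 2)^2 <= 4 KL] gives [tv^2 <= 16 KL = 8 (2 KL)]. *)
rewrite [X in 8 * X](_ : _ = 2 * \sum_y q k y * (ln (q k y) - ln (q j y))).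
  rewrite expr_div_n ler_pdivrMr//; set v := \sum_y _.
  by move=> /le_trans; apply; lra.
rewrite mulr_sumr; apply: eq_bigr => y _.
have := m0 y; rewrite le_eqVlt => /predU1P[/esym my|my].
  have := mq k y my; rewrite /q => /eqP; rewrite mulf_eq0 invr_eq0 pnatr_eq0 orbF.
  by move=> /eqP ->; rewrite !mul0r mulr0.
have qpos i : 0 < q i y by rewrite divr_gt0// ltr_wpDl ?(dQ i).1.
have lE i : log_ratio i y = ln (q i y) - ln (mixture y).
  by rewrite -ln_div ?posrE// /log_ratio /q; congr ln; field; rewrite gt_eqF.
rewrite !lE (_ : Q k y + mixture y = 2 * q k y); last by rewrite /q; field.
by ring.
Qed.

(** * The private channel and the leading hypothesis *)

Definition report : Type := ('I_K * bool)%type.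
HB.instance Definition _ := Finite.on report.

(** The flag [true] stands for the sign -1. The divisor 4 keeps the perturbation of the uniform law
    within [eps / 4]. *)
Definition channel_mass (y : 'I_M) (o : report) : R :=
  (2 * K%:R)^-1 * (1 + (-1) ^+ o.2 * (eps / (4 * A)) * log_ratio o.1 y).

Lemma channel_perturbation y (o : report) :
  `|(-1) ^+ o.2 * (eps / (4 * A)) * log_ratio o.1 y| <= eps / 4.
Proof.
have c0 : 0 <= eps / (4 * A) by rewrite divr_ge0 ?mulr_ge0// ltW.
rewrite normrM normrM normr_sign mul1r ger0_norm//.
apply: le_trans (ler_wpM2l c0 (log_ratio_bound _ _)) _.
by rewrite le_eqVlt; apply/orP; left; apply/eqP; field; rewrite gt_eqF.
Qed.

Lemma sum_report (F : report -> R) : \sum_o F o = \sum_i (F (i, false) + F (i, true)).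
Proof.
rewrite (eq_bigr (fun o : report => F (o.1, o.2))) => [|[]//].
rewrite -(pair_bigA _ (fun i b => F (i, b)))/=; apply: eq_bigr => i _.
by rewrite big_bool addrC.
Qed.

Lemma channel_mass_ge0 y o : 0 <= channel_mass y o.
Proof.
apply: mulr_ge0; first by rewrite invr_ge0 mulr_ge0.
have := channel_perturbation y o; set u := _ * log_ratio _ _.
by rewrite ler_norml; move: u eps1 => u e1 /andP[h _]; lra.
Qed.

Lemma channel_mass_sum1 y : \sum_o channel_mass y o = 1.
Proof.
rewrite sum_report (eq_bigr (fun=> K%:R^-1)) => [|i _].
  by rewrite sumr_const card_ord -[_ *+ _]mulr_natl divff// gt_eqF.
by rewrite /channel_mass/= expr0 expr1; field; rewrite !gt_eqF.
Qed.

Definition channel y : finite_dist R report :=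
  FiniteDist (channel_mass_ge0 y) (channel_mass_sum1 y).

Definition encode (o : report) : K.-tuple R :=
  [tuple if i == o.1 then (-1) ^+ o.2 else 0 | i < K].

Lemma encode_inj : injective encode.
Proof.
move=> [i b] [j c] ij.
have /(congr1 (fun z => tnth z i)) := ij; rewrite !tnth_mktuple/= eqxx.
case: eqP => [-> /signr_inj -> //|_ /eqP].
by rewrite signr_eq0.
Qed.

Definition decode_report := decode encode (k0, false).

Definition sign_mechanism T : mechanism R K M T :=
  fun _ y => finite_law encode (channel y).

(** [1 + eps / 4 <= (1 + eps) (1 - eps / 4)] for [eps <= 1], and [1 + eps <= expR eps]. *)
Lemma channel_ldp y y' o : channel_mass y o <= expR eps * channel_mass y' o.
Proof.
have := channel_perturbation y o; have := channel_perturbation y' o.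
rewrite /channel_mass; set u := _ * log_ratio _ y; set u' := _ * log_ratio _ y'.
rewrite !ler_norml => /andP[u'1 u'2] /andP[u1 u2].
rewrite mulrCA ler_pM2l ?invr_gt0 ?mulr_gt0//.
move: u u' u'1 u'2 u1 u2 (expR_ge1Dx eps) eps0 eps1 => u u' u'1 _ _ u2 he e0 e1.
apply: (@le_trans _ _ ((1 + eps) * (1 - eps / 4))); first by nra.
by apply: ler_pM => //; lra.
Qed.

Lemma sign_mechanism_ldp T : ldp eps (sign_mechanism (T := T)).
Proof.
move=> t y y' S _; rewrite /sign_mechanism/= /finite_law ge0_sume_distrr.
  apply: lee_sum => o _; rewrite muleA; apply: lee_wpmul2r => //.
  by rewrite -EFinM lee_fin; exact: channel_ldp.
by move=> o _; rewrite mule_ge0// lee_fin channel_mass_ge0.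
Qed.

(** The coordinate [k] of [encode o]. *)
Definition vote (k : 'I_K) (o : report) : R :=
  if o.1 == k then (-1) ^+ o.2 else 0.

(** Under the truth [Q j] its mean is [n] times the sum over [y] of
    [(Q j y + mixture y) * log_ratio k y]: the votes are rescaled to be unbiased, and the mixture
    part is exact. *)
Definition score n (o : n.-tuple report) (k : 'I_K) : R :=
  4 * A * K%:R / eps * (\sum_s vote k (tnth o s)) +
  n%:R * \sum_y mixture y * log_ratio k y.

Definition leader n (o : n.-tuple report) : 'I_K :=
  Order.arg_max k0 xpredT (score o).

Lemma leader_max n (o : n.-tuple report) k : score o k <= score o (leader o).
Proof. by rewrite /leader; case: arg_maxP => // i _; exact. Qed.

Definition leader_predictor T : predictors R K M T :=
  fun _ z => Q (leader (map_tuple decode_report z)).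

(** * Deviation of the scores under a fixed truth *)

Section truth.
Context (k : 'I_K).

Definition report_law (o : report) : R := \sum_y Q k y * channel_mass y o.
Local Notation w := report_law.

(** The mean of [vote j] under [report_law]. *)
Definition drift (j : 'I_K) : R :=
  eps / (4 * A * K%:R) * \sum_y Q k y * log_ratio j y.

Lemma report_lawE o : w o = (2 * K%:R)^-1 + (-1) ^+ o.2 * drift o.1 / 2.
Proof.
rewrite /report_law /drift /channel_mass.
rewrite (eq_bigr (fun y => Q k y * (2 * K%:R)^-1 +
    (-1) ^+ o.2 * (eps / (4 * A * K%:R)) / 2 * (Q k y * log_ratio o.1 y))) => [|y _].
  by rewrite big_split/= -mulr_suml (dQ k).2 mul1r -mulr_sumr; ring.
by field; rewrite !gt_eqF.
Qed.

Lemma report_law_ge0 o : 0 <= w o.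
Proof. by apply: sumr_ge0 => y _; rewrite mulr_ge0 ?channel_mass_ge0// (dQ k).1. Qed.

Lemma report_law_sum1 : \sum_o w o = 1.
Proof.
rewrite exchange_big/= -(dQ k).2; apply: eq_bigr => y _.
by rewrite -mulr_sumr channel_mass_sum1 mulr1.
Qed.

(** [vote j] takes the values 1 and -1 with probabilities [(1 / K + drift j) / 2] and
    [(1 / K - drift j) / 2], and is 0 otherwise. *)
Lemma sum_report_vote (j : 'I_K) (f : R -> R) :
  \sum_o w o * f (vote j o) =
  f 0 + K%:R^-1 * ((f 1 + f (- 1)) / 2 - f 0) + drift j * ((f 1 - f (- 1)) / 2).
Proof.
transitivity (\sum_o (w o * f 0 + w o * (f (vote j o) - f 0))).
  by apply: eq_bigr => o _; rewrite -mulrDr addrC subrK.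
rewrite big_split/= -mulr_suml report_law_sum1 mul1r -addrA; congr (_ + _).
rewrite sum_report (bigD1 j)//= big1 => [|i ij].
  rewrite !report_lawE /vote/= eqxx expr0 expr1 addr0.
  by field; rewrite !gt_eqF.
by rewrite /vote/= (negbTE ij) subrr !mulr0 addr0.
Qed.

(** The quadratic bound on [expR] is averaged; the square of a vote has mean only [1 / K]. *)
Lemma vote_mgf (j : 'I_K) (l : R) : `|l| <= 2^-1 ->
  \sum_o w o * expR (l * vote j o) <= expR (l * drift j + 2 * l ^+ 2 / K%:R).
Proof.
move=> l2; apply: le_trans (expR_ge1Dx _).
apply: (@le_trans _ _ (\sum_o w o * (1 + l * vote j o + 2 * (l * vote j o) ^+ 2))).
  apply: ler_sum => o _; apply: ler_wpM2l; first exact: report_law_ge0.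
  apply: expR_le_quadratic; apply: le_trans l2.
  apply: le_trans (ler_norm _) _; rewrite normrM ler_piMr// /vote.
  by case: ifP => _; rewrite ?normr_sign ?normr0.
rewrite (sum_report_vote j (fun x => 1 + l * x + 2 * (l * x) ^+ 2)).
by rewrite le_eqVlt; apply/orP; left; apply/eqP; field; rewrite gt_eqF.
Qed.

Definition noise n (o : n.-tuple report) (j : 'I_K) : R :=
  \sum_s vote j (tnth o s) - n%:R * drift j.

(** The leader beats the truth in observed score, so the mean score gap, which dominates [tv^2], is
    covered by noise alone. *)
Lemma leader_gap n (o : n.-tuple report) :
  n%:R * tv (Q k) (Q (leader o)) ^+ 2 <=
  32 * A * K%:R / eps * (noise o (leader o) - noise o k).
Proof.
have := ler_wpM2l (ler0n R n) (tv_sqr_le_log_ratio k (leader o)).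
move=> /le_trans; apply.
have -> : \sum_y (Q k y + mixture y) * (log_ratio k y - log_ratio (leader o) y) =
   4 * A * K%:R / eps * (drift k - drift (leader o)) +
   (\sum_y mixture y * log_ratio k y - \sum_y mixture y * log_ratio (leader o) y).
  rewrite /drift -mulrBr -!sumrB mulrA [_ * (eps / _)](_ : _ = 1); last first.
    by field; rewrite !gt_eqF.
  by rewrite mul1r -big_split; apply: eq_bigr => y _ /=; ring.
have gap : 0 <= score o (leader o) - score o k by rewrite subr_ge0 leader_max.
(* The two sides differ by exactly eight times the observed score gap. *)
rewrite -subr_ge0; have := mulr_ge0 (ler0n R 8) gap.
rewrite /score /noise; apply: eq_ind; congr (_ <= _).
by field; rewrite gt_eqF.
Qed.

Lemma noise_mgf T (t : 'I_T) (j : 'I_K) (l : R) : `|l| <= 2^-1 ->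
  iid_mean w (fun o => expR (l * noise (tuple_prefix t o) j)) <=
  expR (t%:R * (2 * l ^+ 2 / K%:R)).
Proof.
move=> l2.
rewrite [leLHS](_ : _ = expR (- (l * (t%:R * drift j))) *
    (\sum_o w o * expR (l * vote j o)) ^+ t).
  rewrite -ler_pdivlMl ?expR_gt0// -expRN opprK -expRD.
  rewrite (_ : _ + _ = t%:R * (l * drift j + 2 * l ^+ 2 / K%:R)); last by ring.
  rewrite expRM_natl; apply: lerXn2r; rewrite ?nnegrE ?expR_ge0//.
    by apply: sumr_ge0 => o _; rewrite mulr_ge0 ?report_law_ge0 ?expR_ge0.
  exact: vote_mgf.
rewrite -(iid_mean_prefix_prod _ t report_law_sum1) -iid_meanZ.
apply: eq_bigr => o _; congr (_ * _).
by rewrite -expR_sum -expRD -mulr_sumr -mulrN -mulrDr addrC.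
Qed.

(* l x <= e^(l x - a) + a - 1, summed over both signs and all hypotheses, bounds
   the maximal noise by a function whose mean the moment generating function controls. *)
Lemma leader_tv_sqr_mean_large T (t : 'I_T) : (K <= t)%N ->
  iid_mean w (fun o => tv (Q k) (Q (leader (tuple_prefix t o))) ^+ 2) <=
  256 * A ^+ 2 / eps * Num.sqrt (K%:R / t%:R).
Proof.
move=> Kt; have t0 : 0 < t%:R :> R by rewrite ltr0n; exact: leq_trans Kt.
(* This makes the exponent [t * (2 l^2 / K)] equal to [1 / 2]; [K <= t] ensures [l <= 1 / 2]. *)
pose l : R := Num.sqrt (K%:R / t%:R) / 2.
have l0 : 0 < l by rewrite divr_gt0// sqrtr_gt0 divr_gt0.
have ll : l ^+ 2 = K%:R / t%:R / 4.
  by rewrite expr_div_n sqr_sqrtr ?divr_ge0 ?ler0n//; congr (_ / _); ring.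
have l2 : `|l| <= 2^-1.
  rewrite gtr0_norm// -[leRHS]mul1r ler_pM2r ?invr_gt0// -[leRHS]sqrtr1.
  by rewrite ler_wsqrtr// ler_pdivrMr// mul1r ler_nat.
(* The shift is [A] because the weight [expR (- A) = e^-1 / (1 + K)] pays for the sum over [K]
   hypotheses. *)
pose Z (o : T.-tuple report) := A - 1 + \sum_j
  expR (- A) * (expR (l * noise (tuple_prefix t o) j) +
                expR (- l * noise (tuple_prefix t o) j)).
have ZP o j : `|l * noise (tuple_prefix t o) j| <= Z o.
  rewrite /Z (bigD1 j)//= mulNr; set x := l * noise _ j; rewrite mulrDr -!expRD.
  have : 0 <= \sum_(i < K | i != j) expR (- A) *
      (expR (l * noise (tuple_prefix t o) i) + expR (- l * noise (tuple_prefix t o) i)).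
    by apply: sumr_ge0 => i _; rewrite mulr_ge0 ?addr_ge0 ?expR_ge0.
  have := expR_ge1Dx (- A + x); have := expR_ge1Dx (- A - x).
  have := expR_ge0 (- A + x); have := expR_ge0 (- A - x).
  by rewrite ler_norml => *; apply/andP; split; lra.
have ZE : iid_mean w Z <= 2 * A.
  rewrite iid_meanD iid_mean_cst ?report_law_sum1// iid_mean_sum.
  have mgf (s : R) : `|s| = l -> forall j,
      iid_mean w (fun o => expR (s * noise (tuple_prefix t o) j)) <= expR 1.
    move=> sl j; apply: le_trans (noise_mgf _ _ _) _; first by rewrite sl -(gtr0_norm l0).
    rewrite ler_expR -(real_normK (num_real s)) sl ll.
    rewrite (_ : t%:R * _ = 2^-1); first lra.
    by field; rewrite !gt_eqF.
  apply: (@le_trans _ _ (A - 1 + \sum_(j < K) expR (- A) * (expR 1 + expR 1))).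
    rewrite lerD2l; apply: ler_sum => j _; rewrite iid_meanZ iid_meanD.
    rewrite ler_pM2l ?expR_gt0//; apply: lerD; apply: mgf.
      exact: gtr0_norm.
    by rewrite normrN gtr0_norm.
  have K1 : 0 < 1 + K%:R :> R by rewrite addr_gt0.
  rewrite sumr_const card_ord -[_ *+ K]mulr_natl expRN /log_range expRD lnK ?posrE//.
  rewrite (_ : K%:R * _ = 2 * (K%:R / (1 + K%:R))); last first.
    by field; rewrite !gt_eqF ?expR_gt0.
  have : K%:R / (1 + K%:R) <= 1 :> R by rewrite ler_pdivrMr// mul1r lerDr.
  have := log_range_ge1; rewrite /log_range.
  by move: (ln _) (_ / _) => a b *; lra.
apply: (@le_trans _ _ (iid_mean w (fun o => 64 * A * K%:R / (eps * t%:R * l) * Z o))).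
  apply: ler_iid_mean => [|o]; first exact: report_law_ge0.
  have := leader_gap (tuple_prefix t o); set v := tv _ _; set n1 := noise _ _; set n2 := noise _ _.
  have := ZP o (leader (tuple_prefix t o)); have := ZP o k.
  rewrite -/n1 -/n2 !ler_norml => /andP[h1 _] /andP[_ h2] gap.
  rewrite -(ler_pM2l t0); apply: le_trans gap _.
  rewrite (_ : t%:R * _ = 32 * A * K%:R / eps * (2 * Z o / l)); last first.
    by field; rewrite !gt_eqF.
  apply: ler_wpM2l; first by rewrite divr_ge0 ?mulr_ge0// ltW.
  by rewrite ler_pdivlMr// mulrC mulrBr; lra.
rewrite iid_meanZ; apply: le_trans (ler_wpM2l _ ZE) _.
  by rewrite divr_ge0 ?mulr_ge0// ltW.
have lE : Num.sqrt (K%:R / t%:R) = 2 * l by rewrite /l; field.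
rewrite lE (_ : 64 * _ * _ / _ * _ = 128 * A ^+ 2 / eps * (K%:R / t%:R / l)); last first.
  by field; rewrite !gt_eqF.
rewrite (_ : K%:R / t%:R = 4 * l ^+ 2); last by rewrite ll; field; rewrite gt_eqF.
by rewrite le_eqVlt; apply/orP; left; apply/eqP; field; rewrite !gt_eqF.
Qed.

(** For [t < K] the right side exceeds 1. Otherwise [1 / t <= 4 / (t + 1)] costs a factor 2 and
    removes the singularity at [t = 0]. *)
Lemma leader_tv_sqr_mean T (t : 'I_T) :
  iid_mean w (fun o => tv (Q k) (Q (leader (tuple_prefix t o))) ^+ 2) <=
  512 * A ^+ 2 / eps * Num.sqrt (K%:R / t.+1%:R).
Proof.
have A1 : 1 <= A ^+ 2 by exact: exprn_ege1 log_range_ge1.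
have AE : 1 <= A ^+ 2 / eps by rewrite ler_pdivlMr// mul1r (le_trans eps1).
have [Kt|tK] := leqP K t.
  apply: le_trans (leader_tv_sqr_mean_large Kt) _.
  rewrite (_ : 512 * A ^+ 2 / eps * _ =
    256 * A ^+ 2 / eps * (2 * Num.sqrt (K%:R / t.+1%:R))); last by ring.
  apply: ler_wpM2l; first by rewrite divr_ge0 ?mulr_ge0 ?exprn_ge0// ltW.
  have t0 : (0 < t)%N := leq_trans K0 Kt.
  have -> : 2 * Num.sqrt (K%:R / t.+1%:R) = Num.sqrt (2 ^+ 2 * (K%:R / t.+1%:R)) :> R.
    by rewrite [RHS]sqrtrM ?exprn_ge0// sqrtr_sqr ger0_norm.
  rewrite ler_wsqrtr// mulrCA ler_pM2l// ler_pdivlMr ?ltr0n// mulrC.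
  rewrite ler_pdivrMr ?ltr0n// -natrX -natrM ler_nat.
  by lia.
apply: (@le_trans _ _ 1).
  rewrite -[leRHS](iid_mean_cst report_law_sum1 T); apply: ler_iid_mean => [|o].
    exact: report_law_ge0.
  by rewrite exprn_ile1// ?tv_ge0// tv_le1.
have : 1 <= Num.sqrt (K%:R / t.+1%:R) :> R.
  by rewrite -[leLHS]sqrtr1 ler_wsqrtr// ler_pdivlMr ?ltr0n// mul1r ler_nat.
rewrite -[512 * _ / _]mulrA; move: (A ^+ 2 / eps) (Num.sqrt _) AE => a b a1 b1.
by nra.
Qed.

End truth.
End hypothesis_selection.

(** * Risk and median boosting *)

(** Telescoping: [1 / b <= 2 (b - a)] for [b^2 = a^2 + 1], which amounts to [0 <= (a - b)^2]. *)
Lemma sum_sqrt_inv_le (R : realType) (x : R) T : 0 <= x ->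
  \sum_(t < T) Num.sqrt (x / t.+1%:R) <= 2 * Num.sqrt (x * T%:R).
Proof.
move=> x0; elim: T => [|T IH]; first by rewrite big_ord0 mulr_ge0// sqrtr_ge0.
rewrite big_ord_recr/=; apply: le_trans (lerD IH (lexx _)) _.
rewrite !sqrtrM// sqrtrV ?ler0n//.
have b0 : 0 < Num.sqrt T.+1%:R :> R by rewrite sqrtr_gt0 ltr0n.
have ab : Num.sqrt T.+1%:R ^+ 2 = Num.sqrt T%:R ^+ 2 + 1 :> R.
  by rewrite !sqr_sqrtr ?ler0n// -natr1.
move: b0 ab; move: (Num.sqrt _) (Num.sqrt T%:R) (Num.sqrt x) (sqrtr_ge0 x) => b a s s0 b0 ab.
have ab_le : 2 * a + b^-1 <= 2 * b.
  rewrite -(ler_pM2r b0) mulrDl mulVf ?gt_eqF//.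
  by have := sqr_ge0 (a - b); nra.
rewrite mulrCA -mulrDr [leRHS]mulrCA.
exact: ler_wpM2l.
Qed.

(* The Chernoff bound with the multiplicative weight 4 on bad blocks and 1/4 on
   good ones, whose mean is at most 1/4 + 4/16 <= 1/2. *)
Lemma majority_bad_mean (R : realType) (O : finType) (w : O -> R) m n
    (bad : pred (n.-tuple O)) :
  (forall o, 0 <= w o) -> \sum_o w o = 1 ->
  iid_mean w (fun o => (bad o)%:R) <= 16^-1 ->
  iid_mean w (fun o : (m * n).-tuple O =>
    (m <= 2 * #|[pred j : 'I_m | bad (block o j)]|)%N%:R) <= 2^-1 ^+ m.
Proof.
move=> w0 w1 hbad; pose h (u : n.-tuple O) : R := if bad u then 4 else 4^-1.
have h0 u : 0 <= h u by rewrite /h; case: ifP => _; rewrite ?invr_ge0.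
have hE : iid_mean w h <= 2^-1.
  apply: (@le_trans _ _ (iid_mean w (fun u => 4^-1 + 4 * (bad u)%:R))).
    by apply: ler_iid_mean => // u; rewrite /h; case: (bad u) => /=; lra.
  by rewrite iid_meanD iid_mean_cst// iid_meanZ; lra.
apply: (@le_trans _ _ (iid_mean w h ^+ m)); last first.
  by apply: lerXn2r => //; rewrite nnegrE ?invr_ge0// iid_mean_ge0.
rewrite -iid_mean_blocks; apply: ler_iid_mean => // o.
case: leqP => [le_m|_]; last by apply: prodr_ge0 => j _; exact: h0.
pose b := #|[pred j : 'I_m | bad (block o j)]|.
(* This product is at least 1 since [m <= 2 b]. *)
have -> : \prod_(j < m) h (block o j) = 4 ^+ b * 4^-1 ^+ (m - b).
  rewrite (bigID (fun j => bad (block o j)))/=; congr (_ * _).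
    by rewrite (eq_bigr (fun=> 4)) ?prodr_const// => j bj; rewrite /h bj.
  rewrite (eq_bigr (fun=> 4^-1)) => [|j /negbTE bj]; last by rewrite /h bj.
  rewrite prodr_const; congr (_ ^+ _).
  have := cardC [pred j : 'I_m | bad (block o j)]; rewrite card_ord -/b => bE.
  apply: (@addnI b); rewrite subnKC; last by rewrite -bE leq_addr.
  by rewrite -[in RHS]bE; congr (_ + _)%N; apply: eq_card => j; rewrite !inE.
rewrite exprVn ler_pdivlMr ?exprn_gt0// mul1r.
by apply: ler_weXn2l; [lra|rewrite leq_subLR addnn -mul2n].
Qed.

Section leader_risk.
Context (R : realType) (K M : nat) (Q : 'I_K -> 'I_M -> R) (eps : R) (k0 : 'I_K).
Hypotheses (dQ : forall k, is_dist (Q k)) (eps0 : 0 < eps) (eps1 : eps <= 1).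

Local Notation A := (log_range R K).
Local Notation w := (report_law Q eps).
Local Notation dec := (@decode_report R K k0).
Local Notation Rm T := (@sign_mechanism R K M Q eps k0 dQ eps0 eps1 T).
Local Notation ph T := (@leader_predictor R K M Q eps k0 T : predictors R K M T).

Let K0 : (0 < K)%N. Proof. exact: leq_ltn_trans (ltn_ord k0). Qed.
Let KR : 0 < K%:R :> R. Proof. by rewrite ltr0n K0. Qed.
Let A0 : 0 < A. Proof. exact: lt_le_trans (log_range_ge1 _ _). Qed.
Let w0 k o : 0 <= w k o. Proof. exact: report_law_ge0 k0 dQ eps0 eps1 k o. Qed.
Let w1 k : \sum_o w k o = 1. Proof. exact: report_law_sum1 eps k0 dQ k. Qed.

Let mdec o : measurable (dec @^-1` [set o]).
Proof. by apply: measurable_decode; exact: encode_inj. Qed.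

(** The averaged predictor as a function of decoded reports, so that its risk is a finite sum. *)
Definition leader_average T (o : T.-tuple (report K)) (y : 'I_M) : R :=
  T%:R^-1 * \sum_(t < T) Q (leader Q eps k0 (tuple_prefix t o)) y.

Lemma average_leader_predictor T z :
  average (ph T) z = leader_average (map_tuple dec z).
Proof.
apply/funext => y; rewrite /average /leader_average; congr (_ * _).
apply: eq_bigr => t _; rewrite /leader_predictor; congr (Q (leader _ _ _ _) y).
by apply: eq_from_tnth => s; rewrite !(tnth_map, tnth_mktuple).
Qed.

Lemma is_dist_leader_average T (o : T.-tuple (report K)) :
  (0 < T)%N -> is_dist (leader_average o).
Proof. by move=> T0; apply: is_dist_average. Qed.

Lemma leader_predictor_estimator T t : is_estimator ((ph T) t).
Proof.
split=> [y|z]; last exact: dQ.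
have h := measurable_fun_finite_range (@measurable_map_fiber _ _ _ _ mdec t)
  (fun o => Q (leader Q eps k0 o) y : R).
exact: h.
Qed.

Lemma leader_average_risk T k : (0 < T)%N ->
  iid_mean (w k) (fun o : T.-tuple (report K) => tv (Q k) (leader_average o)) <=
  32 * A * Num.sqrt (eps^-1 * Num.sqrt (K%:R / T%:R)).
Proof.
move=> T0; have TR : 0 < T%:R :> R by rewrite ltr0n.
set s := 32 * A * _.
have s0 : 0 < s.
  by rewrite mulr_gt0 ?mulr_gt0 ?sqrtr_gt0 ?mulr_gt0 ?invr_gt0 ?sqrtr_gt0 ?divr_gt0.
pose TV (o : T.-tuple (report K)) t := tv (Q k) (Q (leader Q eps k0 (tuple_prefix t o))).
(* The 32 in [s] comes from [32^2 = 512 * 2]. *)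
have sumTV : \sum_t iid_mean (w k) (fun o => TV o t ^+ 2) <= T%:R * s ^+ 2.
  apply: (@le_trans _ _ (512 * A ^+ 2 / eps * \sum_(t < T) Num.sqrt (K%:R / t.+1%:R))).
    rewrite mulr_sumr; apply: ler_sum => t _.
    exact: (leader_tv_sqr_mean k0 dQ eps0 eps1 k t).
  apply: le_trans (ler_wpM2l _ (sum_sqrt_inv_le T (ltW KR))) _.
    by apply: divr_ge0; [apply: mulr_ge0; [exact: ler0n|exact: sqr_ge0]|exact: ltW].
  rewrite exprMn sqr_sqrtr; last by rewrite mulr_ge0 ?invr_ge0 ?sqrtr_ge0// ltW.
  rewrite !sqrtrM ?ler0n// sqrtrV ?ler0n//.
  have : T%:R = Num.sqrt T%:R ^+ 2 :> R by rewrite sqr_sqrtr ?ler0n.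
  have : 0 < Num.sqrt T%:R :> R by rewrite sqrtr_gt0.
  move: (Num.sqrt T%:R) => u u0 ->.
  by rewrite le_eqVlt; apply/orP; left; apply/eqP; field; rewrite !gt_eqF.
clearbody s.
(* Jensen's inequality in linear form: [x <= x^2 / (2 s) + s / 2]. *)
apply: (@le_trans _ _ ((2 * s * T%:R)^-1 *
    (\sum_t iid_mean (w k) (fun o => TV o t ^+ 2)) + s / 2)).
  rewrite -iid_mean_sum -iid_meanZ -[X in _ + X](iid_mean_cst (w1 k) T) -iid_meanD.
  apply: ler_iid_mean => // o; apply: le_trans (tv_average_le _ _ T0) _.
  rewrite (_ : s / 2 = (2 * s * T%:R)^-1 * \sum_(t < T) s ^+ 2); last first.
    by rewrite sumr_const card_ord -[_ *+ T]mulr_natl; field; rewrite !gt_eqF.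
  rewrite -mulrDr -big_split (_ : (2 * s * T%:R)^-1 = T%:R^-1 * (2 * s)^-1); last first.
    by rewrite [2 * s * _]mulrC invfM.
  rewrite -mulrA ler_pM2l ?invr_gt0// mulr_sumr; apply: ler_sum => t _.
  rewrite [leRHS]mulrC ler_pdivlMr ?mulr_gt0// -/(TV o t); move: (TV o t) => x /=.
  by rewrite -subr_ge0 (_ : _ - _ = (x - s) ^+ 2) ?sqr_ge0//; ring.

have c0 : 0 <= (2 * s * T%:R)^-1 by rewrite invr_ge0 mulr_ge0 ?mulr_ge0// ltW.
have := lerD (ler_wpM2l c0 sumTV) (lexx (s / 2)); move=> /le_trans; apply.
by rewrite le_eqVlt; apply/orP; left; apply/eqP; field; rewrite !gt_eqF.
Qed.

Lemma sign_mechanism_decode T t y o :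
  Rm T t y (dec @^-1` [set o]) = (channel_mass Q eps y o)%:E.
Proof.
exact: (finite_law_decode _ (@encode_inj R K) (channel k0 dQ eps0 eps1 y)).
Qed.

Lemma tv_risk_leader T k :
  tv_risk (Rm T) (ph T) (Q k) =
  (iid_mean (w k) (fun o : T.-tuple (report K) => tv (Q k) (leader_average o)))%:E.
Proof.
rewrite /tv_risk.
under eq_fun do rewrite average_leader_predictor.
exact: (priv_expectation_iid_mean mdec (@sign_mechanism_decode T)).
Qed.

Lemma leader_risk T k : (0 < T)%N ->
  (tv_risk (Rm T) (ph T) (Q k) <=
   (32 * A * Num.sqrt (eps^-1 * Num.sqrt (K%:R / T%:R)))%:E)%E.
Proof. by move=> T0; rewrite tv_risk_leader lee_fin leader_average_risk. Qed.

(** A median errs by more than [alpha] only if at least half of the independent blocks err by more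
    than [alpha / 3]. *)
Lemma leader_median_estimator T m : (0 < T)%N -> (0 < m)%N ->
  exists est : (m * T).-tuple (K.-tuple R) -> 'I_M -> R,
  [/\ is_estimator est,
      forall z, is_tv_median (fun j => average (ph T) (block z j)) (est z) &
      forall k alpha, 0 < alpha -> (tv_risk (Rm T) (ph T) (Q k) <= (alpha / 48)%:E)%E ->
        ((1 - 2^-1 ^+ m)%:E <=
          priv_probability (repeat_mechanism m (Rm T)) (Q k)
            [set z | (tv (Q k) (est z) <= alpha)%R])%E].
Proof.
move=> T0 m0.
have medP o : exists c, is_tv_median
    (fun j : 'I_m => leader_average (block (o : (m * T).-tuple (report K)) j)) c.
  exact: tv_median_exists.
(* Medians are chosen per decoded report string; finitely many values make the estimator
   measurable. *)
have [g gP] := choice medP.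
have blockE z : (fun j : 'I_m => average (ph T) (block z j)) =
    (fun j => leader_average (block (map_tuple dec z) j)).
  apply/funext => j; rewrite average_leader_predictor; congr leader_average.
  by apply: eq_from_tnth => s; rewrite !(tnth_map, tnth_mktuple).
have mfib := @measurable_map_fiber _ _ _ _ mdec (m * T).
exists (g \o map_tuple dec); split=> [|z|k alpha a0].
- split=> [y|z /=]; first exact: (measurable_fun_finite_range mfib (fun o => g o y)).
  by have [[j ->] _] := gP (map_tuple dec z); exact: is_dist_leader_average.
- by rewrite blockE; exact: gP.
rewrite tv_risk_leader lee_fin => risk.
pose good o := (tv (Q k) (g o) <= alpha)%R.
rewrite (_ : [set z | _] = map_tuple dec @^-1` [set o | good o])//.
rewrite priv_probability_expectation; last exact: measurable_finite_range.
rewrite (_ : \1_ _ = (fun z => (good (map_tuple dec z))%:R)); last first.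
  by apply/funext => z; rewrite indicE; congr (nat_of_bool _)%:R; apply/idP/idP; rewrite inE.
rewrite (priv_expectation_iid_mean mdec (W := channel_mass Q eps) _ (Q k)
  (fun o => (good o)%:R)); last by move=> t y o; exact: sign_mechanism_decode.
rewrite lee_fin.
(* Markov's inequality: [(alpha / 48) / (alpha / 3) = 1 / 16]. *)
pose bad (o : T.-tuple (report K)) := alpha / 3 < tv (Q k) (leader_average o).
have hbad : iid_mean (w k) (fun o => (bad o)%:R) <= 16^-1.
  apply: (@le_trans _ _ (iid_mean (w k) (fun o => 3 / alpha * tv (Q k) (leader_average o)))).
    apply: ler_iid_mean => // o; rewrite /bad; case: ltP => [/ltW h|_] /=; last first.
      by rewrite mulr_ge0 ?tv_ge0 ?divr_ge0// ltW.
    by rewrite mulrAC ler_pdivlMr// mul1r; lra.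
  rewrite iid_meanZ; apply: le_trans (ler_wpM2l _ risk) _.
    by rewrite divr_ge0// ltW.
  by rewrite le_eqVlt; apply/orP; left; apply/eqP; field; rewrite gt_eqF.
have := majority_bad_mean m (w0 k) (w1 k) hbad; set B := iid_mean _ _ => hB.
apply: (@le_trans _ _ (1 - B)); first by rewrite lerD2l lerN2.
rewrite lerBlDr -[leLHS](iid_mean_cst (w1 k) (m * T)) -iid_meanD.
apply: ler_iid_mean => // o.
have [_|le_m] := leqP m _; first by rewrite lerDr ler0n.
rewrite addr0 (_ : good o = true)// /good.
rewrite (_ : alpha = 3 * (alpha / 3)); last by field.
apply: (tv_median_le _ (dQ k) (gP o)) => [j|]; first exact: is_dist_leader_average.
pose B1 := [pred j : 'I_m | bad (block o j)].
pose G1 := [pred j : 'I_m | (tv (Q k) (leader_average (block o j)) <= alpha / 3)%R].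
have : (#|B1| + #|G1| = m)%N.
  rewrite -[RHS]card_ord -(cardC B1); congr (_ + _)%N.
  by apply: eq_card => j; rewrite !inE leNgt.
move: le_m; rewrite -/B1 -/G1.
by move: #|B1| #|G1| => b c; lia.
Qed.

End leader_risk.

(** * Sample sizes and the final theorem *)

Lemma polylog_ge (R : realType) (a C x y : R) : 0 <= a -> a <= C -> 0 <= x -> x <= y ->
  a * (1 + ln (1 + x)) ^+ 4 <= polylog C 4 y.
Proof.
move=> a0 aC x0 xy; rewrite /polylog.
have lx : 0 <= ln (1 + x) by rewrite ln_ge0// lerDl.
have lxy : ln (1 + x) <= ln (1 + y) by rewrite ler_ln ?posrE; lra.
apply: ler_pM => //; first by rewrite exprn_ge0// addr_ge0.
by apply: lerXn2r; rewrite ?nnegrE; lra.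
Qed.

(** Inverts the risk bound: such a [t] makes [sqrt (k / t)] at most [eps (alpha / b)^2]. *)
Lemma risk_le_of_sample_size (R : realType) (b k eps alpha t : R) :
  0 < b -> 0 < k -> 0 < eps -> 0 < alpha ->
  b ^+ 4 * (k / (eps ^+ 2 * alpha ^+ 4)) <= t ->
  b * Num.sqrt (eps^-1 * Num.sqrt (k / t)) <= alpha.
Proof.
move=> b0 k0 e0 a0 ht.
have U0 : 0 < b ^+ 4 * (k / (eps ^+ 2 * alpha ^+ 4)).
  by rewrite mulr_gt0 ?divr_gt0 ?mulr_gt0 ?exprn_gt0.
have t0 : 0 < t := lt_le_trans U0 ht.
have h1 : Num.sqrt (k / t) <= eps * (alpha / b) ^+ 2.
  have v0 : 0 <= eps * (alpha / b) ^+ 2 by rewrite mulr_ge0 ?sqr_ge0// ltW.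
  rewrite -[leRHS](ger0_norm v0) -sqrtr_sqr ler_wsqrtr// ler_pdivrMr//.
  apply: le_trans (ler_wpM2l (sqr_ge0 _) ht).
  by rewrite le_eqVlt; apply/orP; left; apply/eqP; field; rewrite !gt_eqF.
have h2 : Num.sqrt (eps^-1 * Num.sqrt (k / t)) <= alpha / b.
  have v0 : 0 <= alpha / b by rewrite divr_ge0// ltW.
  rewrite -[leRHS](ger0_norm v0) -sqrtr_sqr ler_wsqrtr//.
  by rewrite -ler_pdivlMl ?invr_gt0// invrK.
by rewrite mulrC -ler_pdivlMr.
Qed.

(** [expR (1 / 2) <= 2], so [2^m >= expR (m / 2) >= 1 / beta]. *)
Lemma half_expn_le (R : realType) (beta : R) m : 0 < beta ->
  2 * ln beta^-1 <= m%:R -> 2^-1 ^+ m <= beta.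
Proof.
move=> b0 hm.
have h : expR 2^-1 <= 2 :> R by apply: le_trans (expR_le_quadratic _) _; lra.
rewrite -[leRHS]invrK exprVn lef_pV2 ?posrE ?exprn_gt0 ?invr_gt0//.
rewrite -[leLHS]lnK ?posrE ?invr_gt0//.
apply: (@le_trans _ _ (expR 2^-1 ^+ m)).
  by rewrite -expRM_natl ler_expR; lra.
by apply: lerXn2r; rewrite ?nnegrE ?expR_ge0.
Qed.

Theorem mainTheorem5 (R : realType) :
  exists (C : R) (c : nat) (eps0 : R), 0 < C /\ 0 < eps0 /\
  forall (K M : nat) (Q : 'I_K -> 'I_M -> R) (eps : R),
    (0 < K)%N -> (forall k, is_dist (Q k)) -> 0 < eps -> eps <= eps0 ->
  exists (Rm : forall T, mechanism R K M T) (ph : forall T, predictors R K M T),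
    [/\ forall T, ldp eps (Rm T) /\ (forall t, is_estimator (ph T t)),
        forall (T : nat) (k : 'I_K), (0 < T)%N ->
          (tv_risk (Rm T) (ph T) (Q k) <=
            (polylog C c (K%:R * T%:R / eps) *
             Num.sqrt (eps^-1 * Num.sqrt (K%:R / T%:R)))%:E)%E,
        forall alpha : R, 0 < alpha -> alpha <= 1 ->
          exists T : nat, [/\ (0 < T)%N,
            T%:R <= polylog C c (K%:R / (eps * alpha)) *
                    (K%:R / (eps ^+ 2 * alpha ^+ 4)) &
            forall k, (tv_risk (Rm T) (ph T) (Q k) <= alpha%:E)%E]
        &
        forall alpha : R, 0 < alpha -> alpha <= 1 ->
          exists T : nat, [/\ (0 < T)%N,
            T%:R <= polylog C c (K%:R / (eps * alpha)) *
                    (K%:R / (eps ^+ 2 * alpha ^+ 4)),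
            forall k, (tv_risk (Rm T) (ph T) (Q k) <= alpha%:E)%E &
            forall beta : R, 0 < beta -> beta < 1 ->
              exists (m : nat)
                     (est : (m * T).-tuple (K.-tuple R) -> 'I_M -> R),
              [/\ (m * T)%:R <= polylog C c (K%:R / (eps * alpha)) *
                    (K%:R / (eps ^+ 2 * alpha ^+ 4)) * (1 + ln beta^-1),
                  ldp eps (repeat_mechanism m (Rm T)),
                  is_estimator est,
                  forall z, is_tv_median
                              (fun j => average (ph T) (block z j)) (est z) &
                  forall k, ((1 - beta)%:E <=
                    priv_probability (repeat_mechanism m (Rm T)) (Q k)
                      [set z | (tv (Q k) (est z) <= alpha)%R])%E]]].
Proof.
(* 32 is the constant of the risk bound, 48 the accuracy lost to the median; the existential keeps
   [b] symbolic. *)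
have [b bE] : exists b : R, b = 48 * 32 by exists (48 * 32).
have b1 : 1 <= b by rewrite bE; lra.
have b4 : b <= b ^+ 4 by rewrite -[leLHS]expr1 ler_weXn2l.
(* The sample size contains the fourth power of [b * log_range]; one factor 2 pays for rounding [T]
   up, the other for the number of blocks. *)
exists (4 * b ^+ 4), 4%N, 1.
split; first by rewrite mulr_gt0 ?exprn_gt0//; apply: lt_le_trans b1.
split=> // K M Q eps K0 dQ eps0 eps1.
pose k0 := Ordinal K0.
exists (@sign_mechanism R K M Q eps k0 dQ eps0 eps1), (@leader_predictor R K M Q eps k0).
have K1 : 1 <= K%:R :> R by rewrite ler1n.
have KR : 0 < K%:R :> R by apply: lt_le_trans K1.
have A1 := log_range_ge1 R K.
have A4 : log_range R K <= log_range R K ^+ 4 by rewrite -[leLHS]expr1 ler_weXn2l.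
have polylogC a x : 0 <= a -> a <= 4 * b ^+ 4 -> K%:R <= x ->
    a * log_range R K ^+ 4 <= polylog (4 * b ^+ 4) 4 x.
  by move=> a0 aC Kx; apply: polylog_ge => //; exact: ltW.
(* One [T], at accuracy [alpha / 48] and half the allowed size, serves both the risk bound and the
   boosting. *)
have part3 (alpha : R) : 0 < alpha -> alpha <= 1 -> exists T : nat, [/\ (0 < T)%N,
    T%:R <= polylog (4 * b ^+ 4) 4 (K%:R / (eps * alpha)) *
            (K%:R / (eps ^+ 2 * alpha ^+ 4)) / 2 &
    forall k, (tv_risk (@sign_mechanism R K M Q eps k0 dQ eps0 eps1 T)
      (@leader_predictor R K M Q eps k0 T) (Q k) <= (alpha / 48)%:E)%E].
  move=> a0 a1; set U := K%:R / (eps ^+ 2 * alpha ^+ 4).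
  have U1 : 1 <= U.
    rewrite ler_pdivlMr ?mulr_gt0 ?exprn_gt0// mul1r; apply: le_trans K1.
    by rewrite mulr_ile1 ?exprn_ge0 ?exprn_ile1// ltW.
  set L := log_range R K; pose X := (b * L) ^+ 4 * U.
  have b0 : 0 < b := lt_le_trans ltr01 b1.
  have L0 : 0 < L := lt_le_trans ltr01 A1.
  have X1 : 1 <= X by rewrite -[leLHS](mulr1 1) ler_pM// exprn_ege1// -[leLHS](mulr1 1) ler_pM.
  exists (Num.truncn X).+1; split=> // [|k].
    have TX : (Num.truncn X).+1%:R <= 2 * X.
      have : (Num.truncn X)%:R <= X by rewrite truncn_le; lra.
      by rewrite -natr1; lra.
    apply: le_trans TX _; rewrite ler_pdivlMr//.
    rewrite (_ : 2 * X * 2 = 4 * b ^+ 4 * L ^+ 4 * U); last by rewrite /X; ring.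
    rewrite ler_pM2r; last by lra.
    apply: polylogC => //; first by rewrite mulr_ge0// exprn_ge0// ltW.
    rewrite ler_pdivlMr ?mulr_gt0// ler_piMr ?ler0n//.
    by rewrite mulr_ile1// ltW.
  apply: le_trans (leader_risk k0 dQ eps0 eps1 k _) _ => //.
  rewrite lee_fin ler_pdivlMr// mulrC !mulrA -bE.
  apply: risk_le_of_sample_size => //; first exact: mulr_gt0.
  by rewrite ltW// truncnS_gt.
split=> [T|T k T0|alpha a0 a1|alpha a0 a1].
- split=> [|t]; first exact: sign_mechanism_ldp.
  exact: leader_predictor_estimator.
- have T1 : 1 <= T%:R :> R by rewrite ler1n.
  apply: le_trans (leader_risk k0 dQ eps0 eps1 k T0) _.
  rewrite lee_fin; apply: ler_wpM2r; first exact: sqrtr_ge0.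
  (* The logarithm is raised to the exponent shared with the sample size bound. *)
  apply: (@le_trans _ _ (32 * log_range R K ^+ 4)); first by rewrite ler_pM2l.
  apply: polylogC => //; first lra.
  rewrite ler_pdivlMr//; apply: ler_pM => //; first exact: ltW.
  exact: le_trans eps1 T1.
- have [T [T0 TU risk]] := part3 _ a0 a1; exists T.
  set P := polylog _ _ _ * _ in TU *.
  have P0 : 0 <= P by have := ler0n R T; lra.
  split=> // [|k]; first lra.
  by apply: le_trans (risk k) _; rewrite lee_fin; lra.
have [T [T0 TU risk]] := part3 _ a0 a1; exists T.
set P := polylog _ _ _ * _ in TU *.
have P0 : 0 <= P by have := ler0n R T; lra.
split=> // [|k|beta beta0 beta1]; first lra.
  by apply: le_trans (risk k) _; rewrite lee_fin; lra.
have l0 : 0 <= ln beta^-1 by rewrite ln_ge0// invf_ge1// ltW.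
(* At least [2 ln (1 / beta)] blocks, yet at most [2 (1 + ln (1 / beta))], whose factor 2 uses up
   the spare half of the size. *)
pose m := (Num.truncn (2 * ln beta^-1)).+1; exists m.
have [est [estE estM estP]] := leader_median_estimator k0 dQ eps0 eps1 T0 (ltn0Sn _ : (0 < m)%N).
exists est; split=> // [|i|k].
- have hm : m%:R <= 2 * (1 + ln beta^-1) :> R.
    have : (Num.truncn (2 * ln beta^-1))%:R <= 2 * ln beta^-1 by rewrite truncn_le mulr_ge0.
    by rewrite /m -natr1; lra.
  rewrite natrM; apply: le_trans (ler_pM _ _ hm TU) _ => //.
  by rewrite le_eqVlt; apply/orP; left; apply/eqP; field.
- exact: sign_mechanism_ldp.
apply: le_trans (estP k alpha a0 (risk k)); rewrite lee_fin lerD2l lerN2.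
by apply: half_expn_le => //; rewrite ltW// truncnS_gt.
Qed.
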